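(* Let $G$ be a (not necessarily associative) algebra over a field and let $N$ be a subspace of $G$ such that one of the following holds: (a) $N$ is of finite codimension; (b) $N$ is a left ideal and the $G$-module $G/N$ is Noetherian; (c) $N$ is a two-sided ideal and the quotient algebra $G/N$ satisfies the maximality condition for two-sided ideals. Then $G$ contains characteristic subspaces $H_1,H_2,\dots$ such that: 1) the $H_t$ belong to the lattice of subspaces of $G$ generated by the images of $N$ under all automorphisms of $G$; in particular, the subspaces $H_t$ are ideals (one-sided or two-sided) if $N$ is an ideal, and the quotient algebras (quotient modules) $G/H_t$ lie in the formation $\mathcal F$ generated by the algebra (module) $G/N$; 2) for any multilinear element $w(x_1,\dots,x_n)$ of the free (nonassociative) algebra of rank $n\le t$, the set $w(H_t,\dots,H_t)$ is contained in the linear hull of a finite number of images of the set $w(N,\dots,N)$ under automorphisms of $G$; 3) if, in addition, $\operatorname{codim}$ is either the usual codimension (of a subspace of $G$) or a generalised codimension on the lattice of ideals such that the corresponding quotient algebras (modules) lie in $\mathcal F$, then $\operatorname{codim}H_t\le f^{t-1}(\operatorname{codim}N)$, where $f^k(x)$ is the $k$th iteration of the function $f(x)=x(x+1)$.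
   Context: A subspace of an algebra is characteristic if it is invariant with respect to all automorphisms of the algebra. For a left ideal $N$ of $G$, the $G$-module $G/N$ is the quotient space on which $G$ acts by left multiplications. An element $w(x_1,\dots,x_n)$ of the free nonassociative algebra is multilinear if it is a linear combination of nonassociative monomials each containing each of $x_1,\dots,x_n$ exactly once; $w(K,\dots,K)$ denotes the set of all values $w(k_1,\dots,k_n)$ with $k_i\in K$. A formation of algebras (modules) is a class of algebras (modules), closed under isomorphism, that is closed with respect to homomorphic images and subdirect products of two members; the formation generated by an algebra (module) is the smallest formation containing it. The lattice $\mathcal L$ of ideals in 3) is ordered by inclusion (sup is the sum). A function $\operatorname{codim}\colon\mathcal L\to\mathbb R$ is a generalised codimension (with respect to the automorphism group $\operatorname{Aut}G$) if: (1) $\operatorname{codim}N_1\le\operatorname{codim}N_2$ if $N_1\supseteq N_2$; (2) $\operatorname{codim}\phi(K)\le\operatorname{codim}K$ for any $K\in\mathcal L$ and $\phi\in\operatorname{Aut}G$; (3) for any $N_1,N_2\in\mathcal L$ there is a lower bound $L\in\mathcal L$ of $N_1,N_2$ (that is, $L\subseteq N_1\cap N_2$) with $\operatorname{codim}L\le\operatorname{codim}N_1+\operatorname{codim}N_2$; (4) in any family $\mathcal N\subseteq\mathcal L$ there exist $r\le\max_{K\in\mathcal N}\operatorname{codim}K+1$ elements $N_1,\dots,N_r$ such that $\sup\mathcal N=\sup(N_1,\dots,N_r)$.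
   Formalization: For modules, ''closed under isomorphism'' is taken to include isomorphisms twisted by an automorphism φ of G (f(gx)=φ(g)f(x)), so G/φ(N) lies in the formation generated by G/N; with isomorphism over fixed G, claims 1) and 2) fail together. *)

(* Defs.v *)
From HB Require Import structures.
From mathcomp Require Import all_boot all_order all_algebra ring_quotient.
From mathcomp Require Import sesquilinear finmap boolp classical_sets reals.

Set Implicit Arguments.
Unset Strict Implicit.
Unset Printing Implicit Defensive.

Import Order.TTheory GRing.Theory Num.Theory.

Local Open Scope classical_set_scope.
Local Open Scope ring_scope.
Local Open Scope quotient_scope.

(* Linear subspaces of a space of arbitrary (possibly infinite) dimension are
   taken to be boolean predicates of the library's type [submodClosed]; under
   the classical axioms of [boolp] any Prop-valued subspace is of this form. *)
Notation subspace := submodClosed.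

Record nalgebra (F : fieldType) := NAlgebra {
  nalg_sort :> lmodType F;
  nalg_mul : {bilinear nalg_sort -> nalg_sort -> nalg_sort}
}.

Definition nmul (F : fieldType) (G : nalgebra F) (x y : G) : G := nalg_mul G x y.
Notation "x ** y" := (nmul x y) (at level 40, left associativity) : ring_scope.

(* As [G] need not be associative, a [G]-module is a space with an arbitrary
   bilinear action of [G]. *)
Record gmodule (F : fieldType) (G : nalgebra F) := GModule {
  gmod_sort :> lmodType F;
  gmod_act : {bilinear G -> gmod_sort -> gmod_sort}
}.

Definition gact (F : fieldType) (G : nalgebra F) (M : gmodule G) (g : G) (x : M) :
  M := gmod_act M g x.

Section Ideals.
Variables (F : fieldType) (G : nalgebra F).

Definition left_ideal (N : subspace G) :=
  forall g x : G, x \in N -> g ** x \in N.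
Definition right_ideal (N : subspace G) :=
  forall g x : G, x \in N -> x ** g \in N.
Definition ideal (N : subspace G) := left_ideal N /\ right_ideal N.

End Ideals.

Section QuotientSpace.
Variables (F : fieldType) (V : lmodType F) (N : subspace V).

(* [submodClosed], being also meant for semimodules, does not inherit from the
   structure [zmodClosed] that the library's additive quotient expects. *)
Definition subsp : {pred V} := fun x => x \in N.
Fact subsp_zmod : zmod_closed subsp.
Proof. exact: GRing.submod_closedB (submodClosedP N). Qed.
HB.instance Definition _ := GRing.isZmodClosed.Build V subsp subsp_zmod.

Definition quotv := @Quotient.quot V subsp.
HB.instance Definition _ := GRing.Zmodule.on quotv.

Definition piq (x : V) : quotv := \pi x.

Lemma piq_eq (x y : V) : (piq x = piq y) <-> (x - y \in N).
Proof. by rewrite (Quotient.idealrBE subsp); split => /eqP. Qed.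

Lemma piqK (x : quotv) : piq (repr x) = x.
Proof. exact: reprK. Qed.

Lemma repr_piq (x : V) : repr (piq x) - x \in N.
Proof. by apply/piq_eq; rewrite piqK. Qed.

Lemma piqD (x y : V) : piq (x + y) = piq x + piq y.
Proof. exact: (Quotient.pi_add subsp). Qed.

Definition scaleq (a : F) (x : quotv) : quotv := piq (a *: repr x).

Lemma piqZ a (x : V) : scaleq a (piq x) = piq (a *: x).
Proof. by apply/piq_eq; rewrite -scalerBr rpredZ // repr_piq. Qed.

Fact scaleqA a b x : scaleq a (scaleq b x) = scaleq (a * b) x.
Proof. by rewrite -(piqK x) !piqZ scalerA. Qed.
Fact scale1q : left_id 1 scaleq.
Proof. by move=> x; rewrite -(piqK x) piqZ scale1r. Qed.
Fact scaleqDr : right_distributive scaleq +%R.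
Proof.
by move=> a x y; rewrite -(piqK x) -(piqK y) -piqD !piqZ scalerDr piqD.
Qed.
Fact scaleqDl x : {morph scaleq^~ x : a b / a + b}.
Proof. by move=> a b; rewrite -(piqK x) !piqZ scalerDl piqD. Qed.

HB.instance Definition _ := GRing.Zmodule_isLmodule.Build F quotv
  scaleqA scale1q scaleqDr scaleqDl.

Fact piq_linear : linear piq.
Proof. by move=> a x y; rewrite piqD -piqZ. Qed.
HB.instance Definition _ := GRing.isLinear.Build F V quotv _ piq piq_linear.

End QuotientSpace.

Section QuotientModule.
Variables (F : fieldType) (G : nalgebra F) (N : subspace G).
Hypothesis hN : left_ideal N.

Definition actq (g : G) (x : quotv N) : quotv N := piq N (g ** repr x).

Lemma actq_piq g x : actq g (piq N x) = piq N (g ** x).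
Proof. by apply/piq_eq; rewrite /nmul -linearBr; apply/hN/repr_piq. Qed.

Fact actq_bilinear : bilinear_for *:%R *:%R actq.
Proof.
split=> [x a g h | g a x y].
  by rewrite -(piqK x) !actq_piq /nmul linearPl linearP.
by rewrite -(piqK x) -(piqK y) -linearP !actq_piq /nmul linearPr linearP.
Qed.
HB.instance Definition _ :=
  bilinear_isBilinear.Build F G (quotv N) (quotv N) *:%R *:%R actq actq_bilinear.

Definition quot_mod : gmodule G := GModule actq.

End QuotientModule.

Section QuotientAlgebra.
Variables (F : fieldType) (G : nalgebra F) (N : subspace G).
Hypothesis hN : ideal N.

Definition mulq (x y : quotv N) : quotv N := piq N (repr x ** repr y).

Lemma mulq_piq x y : mulq (piq N x) (piq N y) = piq N (x ** y).
Proof.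
apply/piq_eq; set x' := repr _; set y' := repr _.
have -> : x' ** y' - x ** y = x' ** (y' - y) + (x' - x) ** y.
  by rewrite /nmul linearBr linearBl addrA subrK.
by rewrite rpredD //; [apply/hN.1/repr_piq | apply/hN.2/repr_piq].
Qed.

Fact mulq_bilinear : bilinear_for *:%R *:%R mulq.
Proof.
split=> [z a x y | z a x y]; rewrite -(piqK x) -(piqK y) -(piqK z) -linearP.
  by rewrite !mulq_piq /nmul linearPl linearP.
by rewrite !mulq_piq /nmul linearPr linearP.
Qed.
HB.instance Definition _ :=
  bilinear_isBilinear.Build F (quotv N) (quotv N) (quotv N) *:%R *:%R mulq
    mulq_bilinear.

Definition quot_alg : nalgebra F := NAlgebra mulq.

End QuotientAlgebra.

Definition has_dim (F : fieldType) (V : lmodType F) (n : nat) :=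
  exists e : 'I_n -> V,
    forall v : V, exists! c : {ffun 'I_n -> F}, v = \sum_i c i *: e i.

Definition has_codim (F : fieldType) (V : lmodType F) (N : subspace V) n :=
  has_dim (quotv N) n.

Definition submodule (F : fieldType) (G : nalgebra F) (M : gmodule G)
    (U : subspace M) :=
  forall (g : G) (x : M), x \in U -> gact g x \in U.

Definition noetherian_module (F : fieldType) (G : nalgebra F) (M : gmodule G) :=
  forall U : nat -> subspace M,
    (forall n, submodule (U n)) -> (forall n, {subset U n <= U n.+1}) ->
  exists n, forall m, (n <= m)%N -> U m =i U n.

Definition max_condition_ideals (F : fieldType) (A : nalgebra F) :=
  forall P : subspace A -> Prop,
    (forall I, P I -> ideal I) -> (exists I, P I) ->
  exists2 I, P I & forall J, P J -> {subset I <= J} -> J =i I.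

Definition surj (A B : Type) (f : A -> B) := forall y, exists x, f x = y.

Definition alg_hom (F : fieldType) (A B : nalgebra F) (f : {linear A -> B}) :=
  {morph f : x y / x ** y >-> x ** y}.

Definition automorphism (F : fieldType) (G : nalgebra F) (phi : {linear G -> G}) :=
  bijective phi /\ alg_hom phi.

Definition mod_hom (F : fieldType) (G : nalgebra F) (M M' : gmodule G)
    (f : {linear M -> M'}) :=
  forall (g : G) (x : M), f (gact g x) = gact g (f x).

(* Closure under isomorphism is the bijective case of [af_image]; [S] is a
   subdirect product of [A] and [B] when it embeds in their product with both
   projections onto. *)
Record alg_formation (F : fieldType) (C : nalgebra F -> Prop) : Prop := {
  af_image : forall (A B : nalgebra F) (f : {linear A -> B}),
    alg_hom f -> surj f -> C A -> C B;
  af_subdirect : forall (A B S : nalgebra F)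
      (p : {linear S -> A}) (q : {linear S -> B}),
    alg_hom p -> alg_hom q -> surj p -> surj q ->
    injective (fun x => (p x, q x)) -> C A -> C B -> C S
}.

(* A module is regarded as a pair (algebra, space acted upon), and an
   isomorphism of such pairs over [G] is a linear bijection [f] together with
   an automorphism [phi] of [G] such that [f (g x) = phi(g) f(x)].  Thus, for
   an automorphism [phi], the modules [G/N] and [G/phi(N)] are isomorphic,
   although they need not be so with [phi] the identity (they can have
   different annihilators).  Homomorphic images and subdirect products are
   taken over a fixed [G]. *)
Record mod_formation (F : fieldType) (G : nalgebra F) (C : gmodule G -> Prop) :
    Prop := {
  mf_iso : forall (phi : {linear G -> G}) (M M' : gmodule G)
      (f : {linear M -> M'}),
    automorphism phi -> bijective f ->
    (forall (g : G) (x : M), f (gact g x) = gact (phi g) (f x)) -> C M -> C M';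
  mf_image : forall (M M' : gmodule G) (f : {linear M -> M'}),
    mod_hom f -> surj f -> C M -> C M';
  mf_subdirect : forall (M M' S : gmodule G)
      (p : {linear S -> M}) (q : {linear S -> M'}),
    mod_hom p -> mod_hom q -> surj p -> surj q ->
    injective (fun x => (p x, q x)) -> C M -> C M' -> C S
}.

Definition alg_formation_gen (F : fieldType) (A : nalgebra F) : nalgebra F -> Prop :=
  fun B => forall C, alg_formation C -> C A -> C B.

Definition mod_formation_gen (F : fieldType) (G : nalgebra F) (M : gmodule G) :
    gmodule G -> Prop :=
  fun M' => forall C, mod_formation C -> C M -> C M'.

Section Subspaces.
Variables (F : fieldType) (V : lmodType F).

Definition lhull (A : set V) : {pred V} := fun x =>
  `[< forall S : subspace V, (forall a, A a -> a \in S) -> x \in S >].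

Fact lhull_submod A : submod_closed (lhull A).
Proof.
split=> [|a x y /asboolP hx /asboolP hy]; apply/asboolP => S hS.
  exact: rpred0.
by rewrite rpredD ?rpredZ ?hx ?hy.
Qed.
HB.instance Definition _ A :=
  GRing.isSubmodClosed.Build F V (lhull A) (lhull_submod A).

Definition imsub (phi : {linear V -> V}) (K : subspace V) : {pred V} := fun x =>
  `[< exists2 y, y \in K & phi y = x >].

Fact imsub_submod phi K : submod_closed (imsub phi K).
Proof.
split=> [|a _ _ /asboolP[x hx <-] /asboolP[y hy <-]]; apply/asboolP.
  by exists 0; rewrite ?rpred0 ?linear0.
by exists (a *: x + y); rewrite ?linearP // rpredD ?rpredZ.
Qed.
HB.instance Definition _ phi K :=
  GRing.isSubmodClosed.Build F V (imsub phi K) (imsub_submod phi K).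

(* The sublattice, for sum and intersection, generated by a set of subspaces. *)
Inductive lattice_gen (S : set (set V)) : set (set V) :=
| lg_gen A : S A -> lattice_gen S A
| lg_meet A B : lattice_gen S A -> lattice_gen S B -> lattice_gen S (A `&` B)
| lg_join A B : lattice_gen S A -> lattice_gen S B ->
    lattice_gen S [set x + y | x in A & y in B].

End Subspaces.

Section Orbits.
Variables (F : fieldType) (G : nalgebra F).

Definition characteristic (H : subspace G) :=
  forall phi : {linear G -> G}, automorphism phi ->
  {in H, forall x, phi x \in H}.

Definition aut_images (N : subspace G) : set (set G) :=
  [set A | exists2 phi : {linear G -> G}, automorphism phi & A = phi @` [set` N]].

End Orbits.

(* Nonassociative monomials in the variables indexed by ['I_n]. *)
Inductive magma (n : nat) :=
| MVar of 'I_n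
| MMul of magma n & magma n.

Section Magma.
Variable n : nat.

Fixpoint magma_enc (m : magma n) : GenTree.tree 'I_n :=
  match m with
  | MVar i => GenTree.Leaf i
  | MMul a b => GenTree.Node 0 [:: magma_enc a; magma_enc b]
  end.

Fixpoint magma_dec (t : GenTree.tree 'I_n) : option (magma n) :=
  match t with
  | GenTree.Leaf i => Some (MVar i)
  | GenTree.Node _ [:: a; b] =>
      if (magma_dec a, magma_dec b) is (Some a', Some b')
      then Some (MMul a' b') else None
  | _ => None
  end.

Lemma magma_encK : pcancel magma_enc magma_dec.
Proof. by elim=> [i | a ha b hb] //=; rewrite ha hb. Qed.
HB.instance Definition _ := Choice.copy (magma n) (pcan_type magma_encK).

Fixpoint mvars (m : magma n) : seq 'I_n :=
  match m with MVar i => [:: i] | MMul a b => mvars a ++ mvars b end.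

Fixpoint meval (F : fieldType) (G : nalgebra F) (x : 'I_n -> G) (m : magma n) : G :=
  match m with MVar i => x i | MMul a b => meval x a ** meval x b end.

End Magma.

(* The free nonassociative algebra of rank [n]: finitely supported functions
   from the monomials to [F]; its product is not needed here. *)
Definition free_nalg (F : fieldType) (n : nat) := {fsfun magma n -> F with 0}.

Section FreeAlgebra.
Variables (F : fieldType) (n : nat).

Definition multilinear (w : free_nalg F n) :=
  forall m, m \in finsupp w -> perm_eq (mvars m) (enum 'I_n).

Definition feval (G : nalgebra F) (w : free_nalg F n) (x : 'I_n -> G) : G :=
  \sum_(m <- finsupp w) w m *: meval x m.

Definition wvalues (G : nalgebra F) (w : free_nalg F n) (K : subspace G) :
    set G :=
  [set v | exists2 x : 'I_n -> G, (forall i, x i \in K) & v = feval w x].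

End FreeAlgebra.

(* [L] is the set of ideals considered; the values of [codim] outside [L] are
   irrelevant.  In [gc_sup], [K0] is a member of the family [P] at which the
   maximum of [codim] is attained. *)
Record gen_codim (R : realType) (F : fieldType) (G : nalgebra F)
    (L : set (subspace G)) (codim : subspace G -> R) : Prop := {
  gc_mono : forall N1 N2, L N1 -> L N2 -> {subset N2 <= N1} ->
    codim N1 <= codim N2;
  gc_aut : forall (phi : {linear G -> G}) K, automorphism phi -> L K ->
    codim (imsub phi K) <= codim K;
  gc_meet : forall N1 N2, L N1 -> L N2 ->
    exists K, [/\ L K, {subset K <= N1}, {subset K <= N2} &
                  codim K <= codim N1 + codim N2];
  gc_sup : forall (P : set (subspace G)) (K0 : subspace G),
    P `<=` L -> P K0 -> (forall K, P K -> codim K <= codim K0) ->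
    exists r (K : 'I_r -> subspace G),
      [/\ r%:R <= codim K0 + 1, forall i, P (K i) &
          lhull (\bigcup_(J in P) [set` J]) =i lhull (\bigcup_i [set` K i])]
}.

Definition alg_lattice (F : fieldType) (G : nalgebra F) (N : subspace G)
    (hN : ideal N) : set (subspace G) :=
  [set K | exists hK : ideal K, alg_formation_gen (quot_alg hN) (quot_alg hK)].

Definition mod_lattice (F : fieldType) (G : nalgebra F) (N : subspace G)
    (hN : left_ideal N) : set (subspace G) :=
  [set K | exists hK : left_ideal K,
             mod_formation_gen (quot_mod hN) (quot_mod hK)].

(* Main.v *)
Require Import Defs.
From HB Require Import structures.
From mathcomp Require Import all_boot all_order all_algebra ring_quotient.
From mathcomp Require Import sesquilinear finmap boolp classical_sets reals.
Set Implicit Arguments.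
Unset Strict Implicit.
Unset Printing Implicit Defensive.
Import Order.TTheory GRing.Theory Num.Theory.
Local Open Scope classical_set_scope.
Local Open Scope ring_scope.

(** Put [N_1 = N].  Under each of the chain conditions the sum [H_k] of all
    images of [N_k] under automorphisms is [N_k + sum_(phi in S_k) phi(N_k)] for
    a finite set [S_k], taken of least size; then let
    [N_{k+1}] be the intersection of [N_k] and all [phi(N_k)], [phi in S_k].
    Every [H_k] is characteristic, and [H_1 >= H_2 >= ...].  To evaluate [w] on
    [H_t], expand one argument in [H_t] as a sum of images [phi(N_t)]; all other
    arguments lie in [H_t = phi(H_t)], so applying [phi^-1] moves the expanded
    argument to [N_t].  Since [N_t] is in every [phi(N_{t-1})], [phi in S_{t-1}],
    and [H_t] is in [H_{t-1}], a second argument can be moved to [N_{t-1}] in the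
    same way, and so on; after at most [t] steps all arguments lie in [N].
    Finally, [#|S_k| <= codim N_k] for every codimension, which gives
    [codim N_{k+1} <= codim N_k (codim N_k + 1)].  Minimality of [S_k] makes one
    choice work for all codimensions at once. *)

(** * Sums and intersections of subspaces *)

Section Subspaces.
Variables (F : fieldType) (V : lmodType F).
Implicit Types A B U : subspace V.

(* [submodClosed] does not inherit from [zmodClosed], so [rpredB] does not apply. *)
Lemma subspaceB A x y : x \in A -> y \in A -> x - y \in A.
Proof. by move=> xA yA; rewrite -scaleN1r rpredD ?rpredZ. Qed.

Definition sumsub A B : {pred V} := fun x =>
  `[< exists2 a, a \in A & exists2 b, b \in B & x = a + b >].

Lemma sumsubP A B x :
  reflect (exists2 a, a \in A & exists2 b, b \in B & x = a + b)
          (x \in sumsub A B).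
Proof. exact: asboolP. Qed.

Fact sumsub_submod A B : submod_closed (sumsub A B).
Proof.
split=> [|c x y /sumsubP[a ha [b hb ->]] /sumsubP[a' ha' [b' hb' ->]]].
  apply/sumsubP; exists 0; rewrite ?rpred0 //.
  by exists 0; rewrite ?rpred0 ?addr0.
apply/sumsubP; exists (c *: a + a'); first by rewrite rpredD ?rpredZ.
by exists (c *: b + b'); rewrite ?rpredD ?rpredZ // scalerDr addrACA.
Qed.
HB.instance Definition _ A B :=
  GRing.isSubmodClosed.Build F V (sumsub A B) (sumsub_submod A B).

Definition capsub A B : {pred V} := fun x => (x \in A) && (x \in B).

Fact capsub_submod A B : submod_closed (capsub A B).
Proof.
split=> [|c x y /andP[xA xB] /andP[yA yB]]; apply/andP; first by rewrite !rpred0.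
by rewrite !rpredD ?rpredZ.
Qed.
HB.instance Definition _ A B :=
  GRing.isSubmodClosed.Build F V (capsub A B) (capsub_submod A B).

Lemma capsubE A B x : (x \in capsub A B) = (x \in A) && (x \in B).
Proof. by []. Qed.

Lemma imsubP (phi : {linear V -> V}) A x :
  reflect (exists2 y, y \in A & phi y = x) (x \in imsub phi A).
Proof. exact: asboolP. Qed.

Lemma sub_sumsubl A B : {subset A <= sumsub A B}.
Proof.
by move=> x xA; apply/sumsubP; exists x => //; exists 0; rewrite ?rpred0 ?addr0.
Qed.

Lemma sub_sumsubr A B : {subset B <= sumsub A B}.
Proof.
move=> x xB; apply/sumsubP; exists 0; rewrite ?rpred0 //.
by exists x; rewrite ?add0r.
Qed.

Lemma sumsub_min A B U :
  {subset A <= U} -> {subset B <= U} -> {subset sumsub A B <= U}.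
Proof. by move=> AU BU x /sumsubP[a /AU aU [b /BU bU ->]]; rewrite rpredD. Qed.

End Subspaces.

(** * Inverses and composites of automorphisms *)

Lemma automorphism_inv (F : fieldType) (G : nalgebra F) (phi : {linear G -> G}) :
  automorphism phi ->
  exists psi : {linear G -> G},
    [/\ automorphism psi, cancel phi psi & cancel psi phi].
Proof.
move=> [[g phiK gK] phiM].
have glin : linear g := can2_linear phiK gK.
pose m := GRing.isLinear.Build F G G *:%R g glin.
pose psi : {linear G -> G} := HB.pack g m.
exists psi; split=> //; split; first by exists phi.
by move=> x y; apply: (can_inj phiK); rewrite phiM /= !gK.
Qed.

Lemma automorphism_comp (F : fieldType) (G : nalgebra F)
    (phi psi : {linear G -> G}) :
  automorphism phi -> automorphism psi -> automorphism (phi \o psi).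
Proof.
move=> [bphi hphi] [bpsi hpsi]; split; first exact: bij_comp.
by move=> x y /=; rewrite hpsi hphi.
Qed.

Lemma automorphism_id (F : fieldType) (G : nalgebra F) :
  automorphism (idfun : {linear G -> G}).
Proof. by split; [exists idfun | move=> x y]. Qed.

(** * Finite sums and intersections of images, covers, and chain conditions *)

Section Aut.
Variables (F : fieldType) (G : nalgebra F).

Definition aut := {phi : {linear G -> G} | automorphism phi}.
Definition aut_map (phi : aut) : {linear G -> G} := sval phi.
Coercion aut_map : aut >-> GRing.Linear.type.
(** Classical equality serves membership in finite lists of automorphisms, classical choice the
    selection made in [mincover]. *)
HB.instance Definition _ := gen_eqMixin aut.
HB.instance Definition _ := gen_choiceMixin aut.

Lemma aut_mapP (phi : aut) : automorphism phi.
Proof. exact: svalP. Qed.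

Definition aut1 : aut := exist _ _ (automorphism_id G).
Definition autM (phi psi : aut) : aut :=
  exist _ _ (automorphism_comp (aut_mapP phi) (aut_mapP psi)).

Lemma autV (phi : aut) : exists psi : aut, cancel phi psi /\ cancel psi phi.
Proof.
have [psi [apsi phiK psiK]] := automorphism_inv (aut_mapP phi).
by exists (exist _ psi apsi).
Qed.

Implicit Types (K U : subspace G) (phi : aut) (s : seq aut).

Lemma mem_imsub phi K x : x \in K -> phi x \in imsub phi K.
Proof. by move=> xK; apply/imsubP; exists x. Qed.

Lemma imsub_aut1 K : imsub aut1 K =i K.
Proof. by move=> x; apply/imsubP/idP => [[y yK <-] //|xK]; exists x. Qed.

(** This recursion and the next start at [K], so the identity need not be listed in [s]. This saves
    one automorphism and makes the factor in the codimension bound [size s + 1]. *)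
Fixpoint sum_images K s : subspace G :=
  if s is phi :: s' then sumsub (imsub phi K) (sum_images K s') else K.

Fixpoint cap_images K s : subspace G :=
  if s is phi :: s' then capsub (imsub phi K) (cap_images K s') else K.

Lemma sum_images_base K s : {subset K <= sum_images K s}.
Proof. by elim: s => [//|phi s IH] x /IH; apply: sub_sumsubr. Qed.

Lemma sum_images_mem K s phi : phi \in s -> {subset imsub phi K <= sum_images K s}.
Proof.
elim: s => [//|psi s IH]; rewrite inE => /orP[/eqP->|/IH{}IH] x /=.
  exact: sub_sumsubl.
by move/IH; apply: sub_sumsubr.
Qed.

Lemma sum_images_min K s U : {subset K <= U} ->
  (forall phi, phi \in s -> {subset imsub phi K <= U}) ->
  {subset sum_images K s <= U}.
Proof.
move=> KU; elim: s => [//|psi s IH] sU /=; apply: sumsub_min.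
  by apply: sU; rewrite mem_head.
by apply: IH => phi phis; apply: sU; rewrite inE phis orbT.
Qed.

Lemma cap_images_base K s : {subset cap_images K s <= K}.
Proof. by elim: s => [//|phi s IH] x /andP[_ /IH]. Qed.

Lemma cap_images_mem K s phi : phi \in s -> {subset cap_images K s <= imsub phi K}.
Proof.
elim: s => [//|psi s IH]; rewrite inE => /orP[/eqP->|/IH{}IH] x /andP[//].
by move=> _ /IH.
Qed.

(** Everything built from [N] below arises by these three operations, so a stable property of [N]
    passes to all cores and orbit sums. Being an ideal, lying in the generated lattice and having a
    quotient in the formation are all handled in this way. *)
Record stable_class (C : subspace G -> Prop) : Prop := StableClass {
  stable_cap : forall A B, C A -> C B -> C (capsub A B);
  stable_sum : forall A B, C A -> C B -> C (sumsub A B);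
  stable_im : forall phi A, C A -> C (imsub phi A)
}.

Lemma stable_sum_images C K s : stable_class C -> C K -> C (sum_images K s).
Proof.
move=> hC CK; elim: s => //= phi s IH.
by apply: (stable_sum hC) => //; apply: stable_im.
Qed.

Lemma stable_cap_images C K s : stable_class C -> C K -> C (cap_images K s).
Proof.
move=> hC CK; elim: s => //= phi s IH.
by apply: (stable_cap hC) => //; apply: stable_im.
Qed.

(** Equivalently, the images under [s] together with [K] already give the sum of the whole orbit of
    [K]. *)
Definition covers K s := forall phi, {subset imsub phi K <= sum_images K s}.

Lemma covers_min K : (exists s, covers K s) ->
  exists s, covers K s /\ forall s', covers K s' -> (size s <= size s')%N.
Proof.
case=> s hs; have ex : exists n, `[< exists2 s', covers K s' & size s' = n >].
  by exists (size s); apply/asboolP; exists s.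
case: (ex_minnP ex) => n /asboolP[s0 cs0 <-] nmin; exists s0; split=> // s' cs'.
by apply: nmin; apply/asboolP; exists s'.
Qed.

(** The choice depends on [K] alone. The default [[::]] is taken only when [K] has no finite
    cover. *)
Definition mincover K : seq aut :=
  xget [::] [set s | covers K s /\ forall s', covers K s' -> (size s <= size s')%N].

Lemma mincoverP K : (exists s, covers K s) -> covers K (mincover K).
Proof. by move=> /covers_min[s hs]; rewrite /mincover; case: xgetP => [t _ []|/(_ s)]. Qed.

Lemma size_mincover K s : covers K s -> (size (mincover K) <= size s)%N.
Proof.
move=> cs; have [s' hs'] := covers_min (ex_intro _ s cs).
by rewrite /mincover; case: xgetP => [t _ [_ ->]|/(_ s')].
Qed.

(* [core N k] is the [N_{k+1}] of the introduction. *)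
Fixpoint core N k : subspace G :=
  if k is k'.+1 then cap_images (core N k') (mincover (core N k')) else N.

Definition orbit_sum K : subspace G := sum_images K (mincover K).

Lemma stable_core C N k : stable_class C -> C N -> C (core N k).
Proof. by move=> hC CN; elim: k => //= k; apply: stable_cap_images. Qed.

Lemma stable_orbit_sum C K : stable_class C -> C K -> C (orbit_sum K).
Proof. exact: stable_sum_images. Qed.

(** An automorphism permutes the orbit of [K], hence preserves its sum. In the form H <= phi^-1(H)
    this need only be tested on the finitely many summands. *)
Lemma characteristic_orbit_sum K : (exists s, covers K s) ->
  characteristic (orbit_sum K).
Proof.
move=> /mincoverP cov phi aphi; pose p : aut := exist _ phi aphi.
have [q [pK qK]] := autV p.
suff sub : {subset orbit_sum K <= imsub q (orbit_sum K)}.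
  by move=> x /sub /imsubP[y yH <-]; rewrite (qK y : phi (q y) = y).
apply: sum_images_min => [x xK|psi _ _ /imsubP[x xK <-]]; apply/imsubP.
  by exists (p x); rewrite ?pK //; apply/(cov p)/mem_imsub.
exists (p (psi x)); rewrite ?pK //.
exact: (cov (autM p psi) _ (mem_imsub _ xK)).
Qed.

(** For [C] the left ideals or the ideals, this is the ascending chain condition on [G/K], phrased
    inside [G] so that [K] can vary. *)
Definition acc (C : subspace G -> Prop) K :=
  forall U : nat -> subspace G,
    (forall n, C (U n)) -> (forall n, {subset K <= U n}) ->
    (forall n, {subset U n <= U n.+1}) ->
  exists n, forall m, (n <= m)%N -> {subset U m <= U n}.

Lemma chain_mono (U : nat -> subspace G) : (forall n, {subset U n <= U n.+1}) ->
  forall m n, (m <= n)%N -> {subset U m <= U n}.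
Proof.
move=> hU m n /subnK <-; elim: (n - m)%N => [|k IH] x //.
by move/IH/hU.
Qed.

(* By the modular law, the chain [U n] is controlled by the two chains
   [A + U n] and [B + (A :&: U n)]. *)
Lemma acc_cap C A B : stable_class C -> C A -> C B ->
  acc C A -> acc C B -> acc C (capsub A B).
Proof.
move=> hC CA CB accA accB U CU subU incU.
have [n1 hn1] : exists n, forall m, (n <= m)%N ->
    {subset sumsub A (U m) <= sumsub A (U n)}.
  apply: (accA (fun n => sumsub A (U n))) => [n|n|n].
  - exact: stable_sum.
  - exact: sub_sumsubl.
  by apply: sumsub_min; [exact: sub_sumsubl | move=> x /incU; apply: sub_sumsubr].
have [n2 hn2] : exists n, forall m, (n <= m)%N ->
    {subset sumsub B (capsub A (U m)) <= sumsub B (capsub A (U n))}.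
  apply: (accB (fun n => sumsub B (capsub A (U n)))) => [n|n|n].
  - by apply: stable_sum => //; apply: stable_cap.
  - exact: sub_sumsubl.
  apply: sumsub_min; first exact: sub_sumsubl.
  by move=> x /andP[xA /incU xU]; apply: sub_sumsubr; rewrite capsubE xA.
pose n := maxn n1 n2.
(* In x = b + c both x and c lie in [A], hence so does b, and b is in the intersection of [A] and
   [B], which every [U n] contains. The closing lines repeat this with [A] in place of [B], using
   the present claim to absorb a. *)
have capn m : (n <= m)%N -> {subset capsub A (U m) <= U n}.
  move=> nm x xAU; have [xA xU] := andP xAU.
  have := hn2 m (leq_trans (leq_maxr _ _) nm) x (sub_sumsubr _ xAU).
  case/sumsubP => b bB [c /andP[cA cU] def_x].
  have cUn : c \in U n by apply: chain_mono cU => //; exact: leq_maxr.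
  have bA : b \in A by rewrite -[b](addrK c) -def_x subspaceB.
  by rewrite def_x rpredD // subU // capsubE bA.
exists n => m nm x xU.
have := hn1 m (leq_trans (leq_maxl _ _) nm) x (sub_sumsubr _ xU).
case/sumsubP => a aA [c cU def_x].
have cUn : c \in U n by apply: chain_mono cU => //; exact: leq_maxl.
have aU : a \in U m.
  by rewrite -[a](addrK c) -def_x subspaceB // (chain_mono incU nm).
by rewrite def_x rpredD // (capn m) // capsubE aA.
Qed.

Lemma acc_im C phi A : stable_class C -> acc C A -> acc C (imsub phi A).
Proof.
move=> hC accA U CU subU incU; have [psi [phiK psiK]] := autV phi.
have [n hn] : exists n, forall m, (n <= m)%N ->
    {subset imsub psi (U m) <= imsub psi (U n)}.
  apply: (accA (fun n => imsub psi (U n))) => [n|n x xA|n].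
  - exact: stable_im.
  - by apply/imsubP; exists (phi x); rewrite ?phiK // subU // mem_imsub.
  by move=> _ /imsubP[x xU <-]; apply/mem_imsub/incU.
exists n => m nm x xU.
have /imsubP[y yU /(can_inj psiK) <- //] := hn m nm _ (mem_imsub psi xU).
Qed.

(** Otherwise, adjoining again and again an image not yet contained in the sum would produce a
    strictly increasing chain in [C] above [K]. *)
Lemma acc_covers C K : stable_class C -> C K -> acc C K ->
  exists s, covers K s.
Proof.
move=> hC CK accK; apply: contrapT => /forallNP ncov.
have /choice[next hnext] s : exists phi, ~ {subset imsub phi K <= sum_images K s}.
  by apply/existsNP/ncov.
pose chain := fix chain n := if n is n'.+1 then next (chain n') :: chain n' else [::].
have [n hn] : exists n, forall m, (n <= m)%N ->
    {subset sum_images K (chain m) <= sum_images K (chain n)}.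
  apply: (accK (fun n => sum_images K (chain n))) => n.
  - exact: stable_sum_images.
  - exact: sum_images_base.
  - by move=> x /=; apply: sub_sumsubr.
apply: (hnext (chain n)) => x xK; apply: (hn n.+1) => //=.
exact: sub_sumsubl.
Qed.

(** A core is a finite intersection of images of the previous one, so [acc_cap] and [acc_im] carry
    the condition along; each core can then be covered in its turn. *)
Lemma acc_core C N k : stable_class C -> C N -> acc C N -> acc C (core N k).
Proof.
move=> hC CN accN; elim: k => //= k IH.
have CK : C (core N k) by apply: stable_core.
elim: (mincover _) => //= phi s IHs; apply: acc_cap => //.
- exact: stable_im.
- exact: stable_cap_images.
- exact: acc_im.
Qed.

End Aut.

(** * Stability of ideals and of the generated lattice *)

Section StableClasses.
Variables (F : fieldType) (G : nalgebra F).
Implicit Types (A B N : subspace G).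

Lemma stable_classI (C D : subspace G -> Prop) :
  stable_class C -> stable_class D -> stable_class (fun A => C A /\ D A).
Proof.
move=> hC hD; split=> [A B [CA DA] [CB DB]|A B [CA DA] [CB DB]|phi A [CA DA]].
- by split; apply: stable_cap.
- by split; apply: stable_sum.
- by split; apply: stable_im.
Qed.

Lemma stable_left_ideal : stable_class (@left_ideal F G).
Proof.
split=> [A B hA hB g x /andP[xA xB]|A B hA hB g _ /sumsubP[a aA [b bB ->]]|].
- by rewrite capsubE hA ?hB.
- rewrite /nmul linearDr; apply/sumsubP; exists (g ** a); first exact: hA.
  by exists (g ** b); first exact: hB.
move=> phi A hA g _ /imsubP[x xA <-]; have [psi [_ psiK]] := autV phi.
by rewrite -(psiK g) -(aut_mapP phi).2 mem_imsub ?hA.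
Qed.

Lemma stable_right_ideal : stable_class (@right_ideal F G).
Proof.
split=> [A B hA hB g x /andP[xA xB]|A B hA hB g _ /sumsubP[a aA [b bB ->]]|].
- by rewrite capsubE hA ?hB.
- rewrite /nmul linearDl; apply/sumsubP; exists (a ** g); first exact: hA.
  by exists (b ** g); first exact: hB.
move=> phi A hA g _ /imsubP[x xA <-]; have [psi [_ psiK]] := autV phi.
by rewrite -(psiK g) -(aut_mapP phi).2 mem_imsub ?hA.
Qed.

Lemma stable_ideal : stable_class (@ideal F G).
Proof. exact: stable_classI stable_left_ideal stable_right_ideal. Qed.

Lemma setimsub (phi : {linear G -> G}) A : [set` imsub phi A] = phi @` [set` A].
Proof.
apply/seteqP; split=> x /=; first by case/imsubP => y yA <-; exists y.
by case=> y yA <-; apply/imsubP; exists y.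
Qed.

(** An automorphism permutes the generators; its images commute with sums by linearity and with
    intersections by injectivity. *)
Lemma lattice_gen_aut N (phi : aut G) (S : set G) :
  lattice_gen (aut_images N) S -> lattice_gen (aut_images N) (phi @` S).
Proof.
elim=> [_ [psi apsi ->]|A B _ IHA _ IHB|A B _ IHA _ IHB].
- apply: lg_gen; exists (phi \o psi); first exact: automorphism_comp (aut_mapP _) _.
  by rewrite image_comp.
- rewrite (_ : _ @` _ = phi @` A `&` phi @` B); first exact: lg_meet.
  apply/seteqP; split=> [_ [x [xA xB] <-]|_ [[x xA <-] [y yB]]].
    by split; exists x.
  by move/(bij_inj (aut_mapP phi).1) => xy; exists x => //; split=> //; rewrite -xy.
rewrite (_ : _ @` _ = [set x + y | x in phi @` A & y in phi @` B]); first exact: lg_join.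
apply/seteqP; split=> [_ [_ [x xA [y yB <-]] <-]|_ [_ [x xA <-] [_ [y yB <-] <-]]].
  by exists (phi x); [exists x|exists (phi y); [exists y|rewrite linearD]].
by exists (x + y); [exists x => //; exists y|rewrite linearD].
Qed.

Lemma stable_lattice_gen N :
  stable_class (fun A : subspace G => lattice_gen (aut_images N) [set` A]).
Proof.
split=> [A B hA hB|A B hA hB|phi A hA].
- rewrite (_ : [set` _] = [set` A] `&` [set` B]); first exact: lg_meet.
  by apply/seteqP; split=> x /=; rewrite capsubE => /andP.
- rewrite (_ : [set` _] = [set x + y | x in [set` A] & y in [set` B]]).
    exact: lg_join.
  apply/seteqP; split=> x /=.
    by case/sumsubP => a aA [b bB ->]; exists a => //; exists b.
  by case=> a aA [b bB <-]; apply/sumsubP; exists a => //; exists b.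
by rewrite setimsub; apply: lattice_gen_aut.
Qed.

Lemma lattice_gen_self N : lattice_gen (aut_images N) [set` N].
Proof.
apply: lg_gen; exists idfun; first exact: automorphism_id.
by rewrite image_id.
Qed.

End StableClasses.

Arguments stable_left_ideal {F G}.
Arguments stable_right_ideal {F G}.
Arguments stable_ideal {F G}.

(** * Linear maps induced on quotients *)

Section QuotientMaps.
Variables (F : fieldType) (V : lmodType F).

Section Map.
Variables (A B : subspace V) (phi : {linear V -> V}).

(* The inclusion proof is an argument so that linearity can be inferred. *)
Definition quotmap of {in A, forall x, phi x \in B} :=
  fun q : quotv A => piq B (phi (repr q)).

Hypothesis sub : {in A, forall x, phi x \in B}.

Lemma quotmap_piq x : quotmap sub (piq A x) = piq B (phi x).
Proof. by apply/piq_eq; rewrite -linearB; apply/sub/repr_piq. Qed.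

Fact quotmap_linear : linear (quotmap sub).
Proof.
move=> c x y; rewrite -(piqK x) -(piqK y) -linearP !quotmap_piq.
by rewrite linearP linearP.
Qed.
HB.instance Definition _ :=
  GRing.isLinear.Build F (quotv A) (quotv B) _ (quotmap sub) quotmap_linear.
End Map.

Arguments quotmap {A B phi} sub q.

Lemma quotmap_surj (A B : subspace V) (phi : {linear V -> V})
    (sub : {in A, forall x, phi x \in B}) :
  surj phi -> surj (quotmap sub).
Proof.
move=> hphi q; have [x hx] := hphi (repr q).
by exists (piq A x); rewrite quotmap_piq hx piqK.
Qed.

End QuotientMaps.

Arguments quotmap {F V A B phi} sub q.

(** * Quotients by intersections, sums and images stay in the formation *)

Section Formations.
Variables (F : fieldType) (G : nalgebra F).
Implicit Types (A B N : subspace G).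

Lemma surj_aut (phi : aut G) : surj phi.
Proof. by have [psi [_ psiK]] := autV phi; move=> y; exists (psi y). Qed.

Lemma quotmap_mod_hom A B (hA : left_ideal A) (hB : left_ideal B)
    (sub : {in A, forall x, idfun x \in B}) :
  @mod_hom _ _ (quot_mod hA) (quot_mod hB) (quotmap sub).
Proof.
move=> g x; rewrite -(piqK x) /gact /=.
by rewrite actq_piq // !quotmap_piq actq_piq.
Qed.

Lemma quotmap_alg_hom A B (hA : ideal A) (hB : ideal B) (phi : {linear G -> G})
    (sub : {in A, forall x, phi x \in B}) : alg_hom phi ->
  @alg_hom _ (quot_alg hA) (quot_alg hB) (quotmap sub).
Proof.
move=> hphi x y; rewrite -(piqK x) -(piqK y) /nmul /=.
by rewrite mulq_piq // !quotmap_piq mulq_piq // hphi.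
Qed.

Lemma quotmap_pair_inj A B
    (subA : {in capsub A B, forall x, idfun x \in A})
    (subB : {in capsub A B, forall x, idfun x \in B}) :
  injective (fun x => (quotmap subA x, quotmap subB x)).
Proof.
move=> x y; rewrite -(piqK x) -(piqK y) !quotmap_piq => -[/piq_eq hA /piq_eq hB].
by apply/piq_eq; rewrite capsubE hA.
Qed.

Lemma capsub_idl A B : {in capsub A B, forall x, idfun x \in A}.
Proof. by move=> x /andP[]. Qed.
Lemma capsub_idr A B : {in capsub A B, forall x, idfun x \in B}.
Proof. by move=> x /andP[]. Qed.

Lemma surj_id (T : Type) : surj (@idfun T).
Proof. by move=> x; exists x. Qed.

(** G/(A :&: B) is a subdirect product of G/A and G/B, and G/(A + B) is an image of G/A. The map
    from G/A to G/phi(A) respects the action only up to the twist by [phi], so [mf_iso] is needed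
    for it. *)
Lemma stable_mod_lattice N (hN : left_ideal N) : stable_class (mod_lattice hN).
Proof.
split=> [A B [hA fA] [hB fB]|A B [hA fA] [hB fB]|phi A [hA fA]].
- exists (stable_cap stable_left_ideal hA hB) => C formC CN.
  pose subA := @capsub_idl A B; pose subB := @capsub_idr A B.
  apply: (mf_subdirect formC (p := quotmap subA : {linear quot_mod _ -> quot_mod hA})
    (q := quotmap subB : {linear quot_mod _ -> quot_mod hB})).
  + exact: quotmap_mod_hom.
  + exact: quotmap_mod_hom.
  + exact/quotmap_surj/surj_id.
  + exact/quotmap_surj/surj_id.
  + exact: quotmap_pair_inj.
  + exact: fA.
  + exact: fB.
- exists (stable_sum stable_left_ideal hA hB) => C formC CN.
  have subA : {in A, forall x, idfun x \in sumsub A B} by exact: sub_sumsubl.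
  apply: (mf_image formC (f := quotmap subA : {linear quot_mod hA -> quot_mod _})).
  + exact: quotmap_mod_hom.
  + exact/quotmap_surj/surj_id.
  + exact: fA.
exists (stable_im stable_left_ideal phi hA) => C formC CN.
have sub : {in A, forall x, phi x \in imsub phi A} by move=> x; exact: mem_imsub.
apply: (mf_iso formC (phi := phi)
  (f := quotmap sub : {linear quot_mod hA -> quot_mod _}) (aut_mapP phi)).
- have [psi [phiK psiK]] := autV phi.
  have subV : {in imsub phi A, forall x, psi x \in A}.
    by move=> _ /imsubP[x xA <-]; rewrite phiK.
  have subK : cancel (quotmap sub) (quotmap subV).
    by move=> x; rewrite -(piqK x) !quotmap_piq phiK.
  have subVK : cancel (quotmap subV) (quotmap sub).
    by move=> x; rewrite -(piqK x) !quotmap_piq psiK.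
  exact: Bijective subK subVK.
- move=> g x; rewrite -(piqK x) /gact /=.
  rewrite actq_piq // !quotmap_piq actq_piq; last exact: stable_im stable_left_ideal _ _ hA.
  by rewrite (aut_mapP phi).2.
- exact: fA.
Qed.

(** As for modules, except that [phi] induces an ordinary algebra homomorphism of G/A onto G/phi(A),
    so [af_image] is enough. *)
Lemma stable_alg_lattice N (hN : ideal N) : stable_class (alg_lattice hN).
Proof.
have id_hom : alg_hom (idfun : {linear G -> G}) by [].
split=> [A B [hA fA] [hB fB]|A B [hA fA] [hB fB]|phi A [hA fA]].
- exists (stable_cap stable_ideal hA hB) => C formC CN.
  pose subA := @capsub_idl A B; pose subB := @capsub_idr A B.
  apply: (af_subdirect formC (p := quotmap subA : {linear quot_alg _ -> quot_alg hA})
    (q := quotmap subB : {linear quot_alg _ -> quot_alg hB})).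
  + exact: quotmap_alg_hom.
  + exact: quotmap_alg_hom.
  + exact/quotmap_surj/surj_id.
  + exact/quotmap_surj/surj_id.
  + exact: quotmap_pair_inj.
  + exact: fA.
  + exact: fB.
- exists (stable_sum stable_ideal hA hB) => C formC CN.
  have subA : {in A, forall x, idfun x \in sumsub A B} by exact: sub_sumsubl.
  apply: (af_image formC (f := quotmap subA : {linear quot_alg hA -> quot_alg _})).
  + exact: quotmap_alg_hom.
  + exact/quotmap_surj/surj_id.
  + exact: fA.
exists (stable_im stable_ideal phi hA) => C formC CN.
have sub : {in A, forall x, phi x \in imsub phi A} by move=> x; exact: mem_imsub.
apply: (af_image formC (f := quotmap sub : {linear quot_alg hA -> quot_alg _})).
- exact/quotmap_alg_hom/(aut_mapP phi).2.
- exact/quotmap_surj/surj_aut.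
- exact: fA.
Qed.

End Formations.

(** * The two maximality hypotheses as chain conditions above [N] *)

Section ChainConditions.
Variables (F : fieldType) (G : nalgebra F) (N : subspace G).

Definition quotsub (U : subspace G) : {pred quotv N} := fun q =>
  `[< exists2 x, x \in U & piq N x = q >].

Fact quotsub_submod U : submod_closed (quotsub U).
Proof.
split=> [|c _ _ /asboolP[x xU <-] /asboolP[y yU <-]]; apply/asboolP.
  by exists 0; rewrite ?rpred0 ?linear0.
by exists (c *: x + y); rewrite ?linearP // rpredD ?rpredZ.
Qed.
HB.instance Definition _ U :=
  GRing.isSubmodClosed.Build F (quotv N) (quotsub U) (quotsub_submod U).

Lemma mem_quotsub (U : subspace G) x : {subset N <= U} ->
  (piq N x \in quotsub U) = (x \in U).
Proof.
move=> NU; apply/asboolP/idP => [[y yU /piq_eq/NU xy]|xU]; last by exists x.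
by rewrite -(subKr y x) subspaceB.
Qed.

Lemma noetherian_acc (hN : left_ideal N) :
  noetherian_module (quot_mod hN) -> acc (@left_ideal F G) N.
Proof.
move=> noeth U lU NU incU.
have [n hn] : exists n, forall m, (n <= m)%N -> quotsub (U m) =i quotsub (U n).
  apply: (noeth (fun n => quotsub (U n))) => [n g _ /asboolP[x xU <-]|n q].
    by rewrite /gact /= actq_piq // mem_quotsub // lU.
  by rewrite -(piqK q) !mem_quotsub //; apply: incU.
by exists n => m nm x; rewrite -!(mem_quotsub _ (NU _)) hn.
Qed.

Lemma max_condition_acc (hN : ideal N) :
  max_condition_ideals (quot_alg hN) -> acc (@ideal F G) N.
Proof.
move=> maxN U lU NU incU.
pose Q n : subspace (quotv N) := quotsub (U n).
pose P (I : subspace (quot_alg hN)) := exists n, I =i Q n.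
have idP I : P I -> ideal I.
  case=> n In; split=> g x; rewrite !In => /asboolP[y yU <-];
    rewrite -(piqK g) /nmul /= mulq_piq // mem_quotsub //.
    by have [+ _] := lU n; apply.
  by have [_ +] := lU n; apply.
have exP : exists I, P I by exists (Q 0%N), 0%N.
(* The family consists of the terms of the chain modulo [N]; the chain stops at a maximal one. *)
have [I [n In] maxI] := maxN P idP exP.
exists n => m nm x; rewrite -!(mem_quotsub _ (NU _)) -In.
rewrite -(maxI (Q m)); first by [].
  by exists m.
move=> q; rewrite In -(piqK q) !mem_quotsub //; exact: chain_mono.
Qed.

End ChainConditions.

(** * The usual codimension *)

Section Codimension.
Variable F : fieldType.
Implicit Type V : lmodType F.

(** An upper bound for the dimension of V/K that involves no basis: the kernel of [f] lies in [K].
    Intersections are treated by pairing the maps, and bases are recovered in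
    [codim_le_has_codim]. *)
Definition codim_le V (K : subspace V) d :=
  exists f : {linear V -> 'rV[F]_d}, forall x, f x = 0 -> x \in K.

(** The coordinate map of a basis of V/K is linear because coordinates are unique, and it vanishes
    only on [K]. *)
Lemma has_codim_codim_le V (K : subspace V) d : has_codim K d -> codim_le K d.
Proof.
case=> e he.
have /choice[c hc] x : exists c : {ffun 'I_d -> F}, piq K x = \sum_i c i *: e i.
  by have [c [cx _]] := he (piq K x); exists c.
have c_uniq x (b : {ffun 'I_d -> F}) : piq K x = \sum_i b i *: e i -> c x = b.
  have [b0 [_ ub0]] := he (piq K x) => hb.
  by rewrite -(ub0 _ hb) -(ub0 _ (hc x)).
pose f x : 'rV[F]_d := \row_i c x i.
have flin : linear f.
  move=> a x y; rewrite /f (c_uniq _ [ffun i => a * c x i + c y i]).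
    by apply/rowP => i; rewrite !mxE ffunE.
  rewrite linearP /= !hc scaler_sumr -big_split; apply: eq_bigr => i _ /=.
  by rewrite ffunE scalerDl scalerA.
pose fL : {linear V -> 'rV[F]_d} :=
  HB.pack f (GRing.isLinear.Build F V 'rV[F]_d *:%R f flin).
exists fL => x /rowP f0.
rewrite -[x]subr0; apply/piq_eq; rewrite linear0 hc big1 // => i _.
by have := f0 i; rewrite !mxE => ->; rewrite scale0r.
Qed.

Lemma codim_leW V (K : subspace V) d d' :
  (d <= d')%N -> codim_le K d -> codim_le K d'.
Proof.
move=> dd' [f hf].
(* Right multiplication by [pid_mx d] pads a row of length [d] with zeros. *)
exists (mulmxr (pid_mx d : 'M_(d, d')) \o f) => x /= fx0; apply: hf.
have pidK : (pid_mx d : 'M[F]_(d, d')) *m (pid_mx d : 'M_(d', d)) = 1%:M.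
  by rewrite mul_pid_mx minnn (minn_idPr dd') pid_mx_1.
by rewrite -[f x]mulmx1 -pidK mulmxA fx0 mul0mx.
Qed.

Lemma codim_le_sub V (A B : subspace V) d :
  {subset A <= B} -> codim_le A d -> codim_le B d.
Proof. by move=> AB [f hf]; exists f => x /hf/AB. Qed.

Lemma codim_le_cap V (A B : subspace V) d e :
  codim_le A d -> codim_le B e -> codim_le (capsub A B) (d + e).
Proof.
move=> [f hf] [g hg]; pose h x : 'rV[F]_(d + e) := row_mx (f x) (g x).
have hlin : linear h.
  by move=> a x y; rewrite /h !linearP scale_row_mx add_row_mx.
pose hL : {linear V -> 'rV[F]_(d + e)} :=
  HB.pack h (GRing.isLinear.Build F V 'rV[F]_(d + e) *:%R h hlin).
exists hL => x; change (h x = 0 -> x \in capsub A B).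
rewrite /h -row_mx0 => /eq_row_mx[/hf xA /hg xB].
by rewrite capsubE xA.
Qed.

(* Composing with a map whose kernel is spanned by [f x]. *)
Lemma codim_le_pred V (A B : subspace V) x d : {subset A <= B} ->
  x \in B -> x \notin A -> codim_le A d.+1 -> codim_le B d.
Proof.
move=> AB xB xA [f hf]; have fx0 : f x != 0.
  by apply: contra xA => /eqP/hf.
have rk : \rank (cokermx (f x)) = d.
  by rewrite mxrank_coker rank_rV fx0 subn1.
suff : codim_le B (\rank (cokermx (f x))) by rewrite rk.
(* The factor [col_base] has the same kernel as the whole cokernel matrix, but its target has
   dimension [d] instead of [d.+1]. *)
exists (mulmxr (col_base (cokermx (f x))) \o f) => y /= fy0.
have : (f y <= f x)%MS by rewrite submxE -(mulmx_base (cokermx (f x))) mulmxA fy0 mul0mx.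
case/sub_rVP => a def_fy; rewrite -(subrK (a *: x) y) rpredD ?rpredZ //.
by apply/AB/hf; rewrite linearB linearZ /= def_fy subrr.
Qed.

Lemma codim_le0 V (A : subspace V) x : codim_le A 0 -> x \in A.
Proof. by case=> f hf; apply: hf; rewrite [LHS]thinmx0. Qed.

Definition addline V (K : subspace V) (x : V) : {pred V} := fun y =>
  `[< exists a, y - a *: x \in K >].

Fact addline_submod V (K : subspace V) x : submod_closed (addline K x).
Proof.
split=> [|c y z /asboolP[a ha] /asboolP[b hb]]; apply/asboolP.
  by exists 0; rewrite scale0r subr0 rpred0.
exists (c * a + b); rewrite scalerDl opprD addrACA -scalerA -scalerBr.
by rewrite rpredD ?rpredZ.
Qed.
HB.instance Definition _ V (K : subspace V) x :=
  GRing.isSubmodClosed.Build F V (addline K x) (addline_submod K x).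

(* A basis of the quotient by [addline K x] is lifted and completed by the class
   of [x]. *)
Lemma has_codim_addline V (K : subspace V) x e : x \notin K ->
  has_codim (addline K x) e -> has_codim K e.+1.
Proof.
move=> xK [b hb].
pose r i := repr (b i).
exists (fun i => piq K (if unlift ord0 i is Some j then r j else x)).
have sumE (c : {ffun 'I_e.+1 -> F}) :
  \sum_i c i *: piq K (if unlift ord0 i is Some j then r j else x) =
  piq K (c ord0 *: x + \sum_i c (lift ord0 i) *: r i).
  rewrite big_ord_recl unlift_none linearD linearZ linear_sum /=; congr (_ + _).
  by apply: eq_bigr => i _; rewrite liftK linearZ.
have modE (a : F) (c : 'I_e -> F) y :
    piq K y = piq K (a *: x + \sum_i c i *: r i) ->
    piq (addline K x) y = \sum_i c i *: b i.
  move/piq_eq=> yK; have -> : \sum_i c i *: b i =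
      piq (addline K x) (\sum_i c i *: r i).
    by rewrite linear_sum; apply: eq_bigr => i _; rewrite linearZ /= piqK.
  apply/piq_eq/asboolP; exists a.
  by rewrite -addrA -opprD [_ + a *: x]addrC.
move=> v; rewrite -(piqK v); set y := repr v.
have [c [hc uc]] := hb (piq (addline K x) y).
have [a ha] : exists a, y - \sum_i c i *: r i - a *: x \in K.
  apply/asboolP; apply/(piq_eq (addline K x)); rewrite hc linear_sum.
  by apply: eq_bigr => i _; rewrite linearZ /= piqK.
exists [ffun i => if unlift ord0 i is Some j then c j else a]; split.
  rewrite sumE; apply/piq_eq; rewrite ffunE unlift_none.
  under eq_bigr do rewrite ffunE liftK.
  by rewrite opprD addrA addrAC.
move=> c'; rewrite sumE => hc'.
(* Uniqueness: [x] vanishes modulo [addline K x], so [uc] fixes the coordinates at the [r i]. The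
   coordinate at [x] is then fixed too, since a nonzero multiple of [x] in [K] would put [x] in
   [K]. *)
have cE : c = [ffun i => c' (lift ord0 i)].
  apply: uc; rewrite (modE _ _ _ hc').
  by apply: eq_bigr => i _; rewrite ffunE.
have aE : a = c' ord0.
  apply/eqP; rewrite -subr_eq0; apply: contraNT xK => ac.
  rewrite -[x](scalerK ac) rpredZ //; move/piq_eq: hc' => hc'.
  have sumc : \sum_i c' (lift ord0 i) *: r i = \sum_i c i *: r i.
    by apply: eq_bigr => i _; rewrite cE ffunE.
  suff -> : (a - c' ord0) *: x =
      y - (c' ord0 *: x + \sum_i c' (lift ord0 i) *: r i) -
      (y - \sum_i c i *: r i - a *: x) by exact: subspaceB.
  rewrite sumc scalerBl opprD addrA addrAC opprB.
  by rewrite [RHS]addrC addrA subrK.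
apply/ffunP => i; rewrite ffunE; case: unliftP => [j ->|->//].
by rewrite cE ffunE.
Qed.

(** Adjoining to [K] a vector outside it lowers the bound by one, and the basis obtained for the
    larger subspace extends. If no such vector exists, the zero map lowers the bound. *)
Lemma codim_le_has_codim V (K : subspace V) d : codim_le K d ->
  exists2 e, has_codim K e & (e <= d)%N.
Proof.
elim: d K => [|d IH] K cK.
  exists 0%N => //; exists (fun _ => 0) => v.
  exists [ffun _ => 0]; split; last by move=> c _; apply/ffunP => -[].
  rewrite big_ord0 -(piqK v) -(linear0 (piq K)); apply/piq_eq.
  exact: codim_le0.
have [KT|] := pselect (forall x, x \in K).
  case: (IH K) => [|e ? ed]; last by exists e => //; rewrite leqW.
  have [f hf] := cK.
  by exists (\0 : {linear _ -> _}) => x _; apply: KT.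
case/existsNP=> x /negP xK.
case: (IH (addline K x)) => [|e he ed]; last first.
  by exists e.+1; first exact: has_codim_addline he.
apply: codim_le_pred xK cK => [y yK|]; apply/asboolP.
  by exists 0; rewrite scale0r subr0.
by exists 1; rewrite scale1r subrr rpred0.
Qed.

Section Automorphisms.
Variable G : nalgebra F.
Implicit Types K N : subspace G.

Lemma codim_le_im (phi : aut G) K d : codim_le K d -> codim_le (imsub phi K) d.
Proof.
have [psi [_ psiK]] := autV phi.
case=> f hf; exists (f \o psi) => x /= /hf xK.
by rewrite -(psiK x) mem_imsub.
Qed.

Lemma codim_le_cap_images K s d :
  codim_le K d -> codim_le (cap_images K s) (d * (size s + 1)).
Proof.
move=> cK; elim: s => [|phi s IH] /=; first by rewrite muln1.
by rewrite addSn mulnS; apply: codim_le_cap IH; apply: codim_le_im.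
Qed.

(** Each image not contained in the current sum lowers the codimension of that sum by at least one,
    so at most [d] are adjoined. The induction is over the list [s0] gathered so far. *)
Lemma codim_le_covers K d : codim_le K d ->
  exists2 s, covers K s & (size s <= d)%N.
Proof.
suff gen s0 : codim_le (sum_images K s0) d ->
    exists2 s, covers K (s ++ s0) & (size s <= d)%N.
  by move/(gen [::])=> [s cs sd]; exists s => //; rewrite -[s]cats0.
elim: d s0 => [|d IH] s0 cs0.
  by exists [::] => // phi x _; exact: codim_le0.
have [cov|] := pselect (covers K s0); first by exists [::].
case/existsNP=> phi /existsNP[x /not_implyP[xK /negP xs0]].
case: (IH (phi :: s0)) => [|s cs sd].
  apply: codim_le_pred xs0 cs0; last exact: sub_sumsubl.
  exact: sub_sumsubr.
by exists (rcons s phi); rewrite ?cat_rcons // size_rcons.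
Qed.

Lemma codim_le_core N k d : codim_le N d ->
  codim_le (core N k) (iter k (fun x => x * (x + 1))%N d).
Proof.
move=> cN; elim: k => //= k IH; set d' := iter _ _ _.
apply: codim_leW (codim_le_cap_images _ IH).
rewrite leq_mul // leq_add2r.
(* A cover of length at most [d'] exists, and [mincover] is no longer than it. *)
have [s cs sd] := codim_le_covers IH.
exact: leq_trans (size_mincover cs) sd.
Qed.

End Automorphisms.
End Codimension.

(** * Linear hulls *)

Section LinearHull.
Variables (F : fieldType) (G : nalgebra F).
Implicit Types A B : set G.

Lemma sub_lhull A x : A x -> x \in lhull A.
Proof. by move=> Ax; apply/asboolP => S; apply. Qed.

Lemma lhull_min A (S : subspace G) :
  (forall x, A x -> x \in S) -> {subset lhull A <= S}.
Proof. by move=> AS x /asboolP; apply. Qed.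

Lemma lhullS A B : A `<=` B -> {subset lhull A <= lhull B}.
Proof. by move=> AB; apply: lhull_min => x /AB; apply: sub_lhull. Qed.

Lemma lhull_aut (phi : aut G) A x : x \in lhull A -> phi x \in lhull (phi @` A).
Proof.
have [psi [phiK psiK]] := autV phi; move=> xA.
have : x \in imsub psi (lhull (phi @` A)).
  apply: lhull_min xA => y Ay; apply/imsubP; exists (phi y); rewrite ?phiK //.
  by apply: sub_lhull; exists y.
by case/imsubP=> y yA <-; rewrite psiK.
Qed.

End LinearHull.

(** * Values of multilinear elements *)

Section MultilinearValues.
Variables (F : fieldType) (n : nat).

Definition upd T (x : 'I_n -> T) i (y : T) : 'I_n -> T :=
  fun j => if j == i then y else x j.

Lemma meval_upd (G : nalgebra F) (x : 'I_n -> G) i a m :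
  i \notin mvars m -> meval (upd x i a) m = meval x m.
Proof.
elim: m => [j|p IHp q IHq] /=; rewrite ?mem_cat.
  by rewrite inE /upd eq_sym => /negPf ->.
by rewrite negb_or => /andP[/IHp -> /IHq ->].
Qed.

(** The variable occurs once, hence in exactly one factor of a product; the other factor does not
    change. *)
Lemma meval_updD (G : nalgebra F) (x : 'I_n -> G) i a b m :
  count_mem i (mvars m) = 1%N ->
  meval (upd x i (a + b)) m = meval (upd x i a) m + meval (upd x i b) m.
Proof.
elim: m => [j|p IHp q IHq] /=; first by rewrite /upd; case: eqP.
rewrite count_cat.
case Ep: (count_mem i (mvars p)) => [|[|k]] Eq.
- have ip : i \notin mvars p by apply/count_memPn.
  by rewrite IHq // !(meval_upd _ _ ip) /nmul linearDr.
- have iq : i \notin mvars q by apply/count_memPn; case: Eq.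
  by rewrite IHp // !(meval_upd _ _ iq) /nmul linearDl.
- by [].
Qed.

Lemma meval_aut (G : nalgebra F) (phi : aut G) (x : 'I_n -> G) m :
  phi (meval x m) = meval (phi \o x) m.
Proof. by elim: m => //= p IHp q IHq; rewrite (aut_mapP phi).2 IHp IHq. Qed.

Variables (w : free_nalg F n) (G : nalgebra F).
Implicit Types (x : 'I_n -> G) (Ks Ls : 'I_n -> subspace G).

Lemma feval_aut (phi : aut G) x : phi (feval w x) = feval w (phi \o x).
Proof.
rewrite /feval linear_sum; apply: eq_bigr => m _.
by rewrite linearZ /= meval_aut.
Qed.

Lemma feval_updD x i a b : multilinear w ->
  feval w (upd x i (a + b)) = feval w (upd x i a) + feval w (upd x i b).
Proof.
move=> mw; rewrite /feval -big_split /=; apply: eq_big_seq => m /mw pm.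
rewrite meval_updD ?scalerDr //.
by rewrite (seq.permP pm) count_uniq_mem ?enum_uniq // mem_enum.
Qed.

(** Unlike in [wvalues], each argument has its own subspace, as intermediate stages mix cores and
    orbit sums. *)
Definition values Ks : set G :=
  [set v | exists2 x, forall i, x i \in Ks i & v = feval w x].

Lemma valuesS Ks Ls : (forall i, {subset Ks i <= Ls i}) ->
  values Ks `<=` values Ls.
Proof. by move=> KL _ [x xK ->]; exists x => // i; apply/KL/xK. Qed.

Lemma values_im (phi : aut G) Ks :
  values (fun i => imsub phi (Ks i)) `<=` phi @` values Ks.
Proof.
move=> _ [x xK ->]; have [psi [phiK psiK]] := autV phi.
exists (feval w (psi \o x)).
  exists (psi \o x) => // i /=.
  by have /imsubP[y yK <-] := xK i; rewrite phiK.
by rewrite feval_aut; congr feval; apply/funext => i /=; rewrite psiK.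
Qed.

Lemma values_sum Ks i (A B : subspace G) v : multilinear w ->
  values (upd Ks i (sumsub A B)) v ->
  exists a b, [/\ values (upd Ks i A) a, values (upd Ks i B) b & v = a + b].
Proof.
move=> mw [x xK ->].
have := xK i; rewrite /upd eqxx => /sumsubP[a aA [b bB def_x]].
exists (feval w (upd x i a)), (feval w (upd x i b)); split.
- exists (upd x i a) => // j; have := xK j.
  by rewrite /upd; case: eqP => // ->.
- exists (upd x i b) => // j; have := xK j.
  by rewrite /upd; case: eqP => // ->.
rewrite -feval_updD // -def_x; congr feval; apply/funext => j.
by rewrite /upd; case: eqP => // ->.
Qed.

Variable N : subspace G.

(** The order of quantifiers carries the finiteness: one list [L] serves all elements of [S]. *)
Definition spanned (S : set G) := exists L : seq (aut G),
  forall v, S v ->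
    v \in lhull (\bigcup_(phi in [set phi : aut G | phi \in L]) (phi @` wvalues w N)).

Lemma spannedS S T : S `<=` T -> spanned T -> spanned S.
Proof. by move=> ST [L hL]; exists L => v /ST/hL. Qed.

Lemma spanned_im (phi : aut G) S : spanned S -> spanned (phi @` S).
Proof.
case=> L hL; exists [seq autM phi psi | psi <- L] => _ [v Sv <-].
apply: lhullS (lhull_aut phi (hL _ Sv)) => _ [_ [psi psiL [u Nu <-]] <-].
exists (autM phi psi); first exact: map_f.
by exists u.
Qed.

Lemma spanned_add S T U :
  (forall v, S v -> exists a b, [/\ T a, U b & v = a + b]) ->
  spanned T -> spanned U -> spanned S.
Proof.
move=> STU [L hL] [M hM]; exists (L ++ M) => v /STU[a [b [Ta Ub ->]]].
rewrite rpredD //.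
  apply: lhullS (hL _ Ta) => u [psi ? ?]; exists psi => //=.
  by rewrite mem_cat; apply/orP; left.
apply: lhullS (hM _ Ub) => u [psi ? ?]; exists psi => //=.
by rewrite mem_cat; apply/orP; right.
Qed.

Lemma spanned_values_sum_images Ks (i : 'I_n) K (s : seq (aut G)) : multilinear w ->
  spanned (values (upd Ks i K)) ->
  (forall phi : aut G, phi \in s -> spanned (values (upd Ks i (imsub phi K)))) ->
  spanned (values (upd Ks i (sum_images K s))).
Proof.
move=> mw spK; elim: s => [//|phi s IH] sps /=.
apply: (spanned_add (fun v => @values_sum _ _ _ _ v mw)); first exact/sps/mem_head.
by apply: IH => psi psis; apply: sps; rewrite inE psis orbT.
Qed.

Hypothesis cov : forall k, covers (core N k) (mincover (core N k)).

Lemma core_sub k : {subset core N k <= N}.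
Proof. by elim: k => // k IH x /= /cap_images_base/IH. Qed.

Lemma orbit_sum_core_sub k :
  {subset orbit_sum (core N k.+1) <= orbit_sum (core N k)}.
Proof.
apply: sum_images_min => [x /cap_images_base|phi _ x /imsubP[y /cap_images_base yK <-]].
  exact: sum_images_base.
exact: (cov (mem_imsub phi yK)).
Qed.

Lemma spanned_values_core Ks : (forall i, {subset Ks i <= N}) ->
  spanned (values Ks).
Proof.
move=> KN; exists [:: aut1 G] => v [x xK ->]; apply: sub_lhull.
exists (aut1 G); first exact: mem_head.
by exists (feval w x) => //; exists x => // i; apply/KN/xK.
Qed.

(* Argument [j] is expanded over the images [phi K] of [K = core N k]; the
   earlier arguments lie in each [phi K], and the later ones in
   [orbit_sum K = phi (orbit_sum K)], so that [phi] can be taken out. *)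
Lemma spanned_values_step k j : multilinear w -> (j < n)%N ->
  spanned (values (fun i => if (i < j.+1)%N then core N k
                            else orbit_sum (core N k))) ->
  spanned (values (fun i => if (i < j)%N then core N k.+1
                            else orbit_sum (core N k))).
Proof.
set Ls := (Ls in spanned (values Ls) -> _); move=> mw lt_jn spL.
set Ks := (Ks in spanned (values Ks)); pose i0 := Ordinal lt_jn.
pose s := mincover (core N k).
have lt_iS (i : 'I_n) : (i < j.+1)%N = (i < j)%N || (i == i0).
  by rewrite ltnS leq_eqVlt orbC.
apply: (@spannedS _ (values (upd Ks i0 (sum_images (core N k) s)))).
  apply: valuesS => i; rewrite /upd; case: eqP => [->|_] x //.
  by rewrite /Ks ltnn.
apply: spanned_values_sum_images => // [|phi phis].
  apply: spannedS spL; apply: valuesS => i; rewrite /upd /Ls /Ks lt_iS.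
  case: eqP => _; rewrite ?orbT ?orbF; first by move=> x.
  by case: ifP => _ x //; exact: cap_images_base.
apply: spannedS (spanned_im phi spL); apply: subset_trans (@values_im phi Ls).
apply: valuesS => i; rewrite /upd /Ls /Ks lt_iS.
case: eqP => _; rewrite ?orbT ?orbF; first by move=> x.
case: ifP => _; first exact: cap_images_mem.
have [psi [phiK psiK]] := autV phi => x xH; rewrite -(psiK x) mem_imsub //.
by apply: (characteristic_orbit_sum (ex_intro _ _ (@cov k))) (aut_mapP psi) _ xH.
Qed.

(** Each use of [spanned_values_step] puts one more argument in a core and descends one level,
    [orbit_sum_core_sub] adjusting the remaining arguments. The invariant n <= j + k + 1 ensures
    that all arguments reach a core, hence [N], before the levels run out. *)
Lemma spanned_values_mixed k j : multilinear w -> (n <= j + k.+1)%N ->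
  spanned (values (fun i => if (i < j)%N then core N k.+1
                            else orbit_sum (core N k))).
Proof.
(* With [k'.-1] the claim fits both the goal at level [k], where [k'] is [k.+1], and the bottom case
   [k' = 0], where the predecessor is again 0. *)
move=> mw; have all_core k' j' : (n <= j')%N -> spanned (values (fun i : 'I_n =>
    if (i < j')%N then core N k' else orbit_sum (core N k'.-1))).
  move=> le_nj; apply: spanned_values_core => i.
  by rewrite (leq_trans (ltn_ord i) le_nj); exact: core_sub.
elim: k j => [|k IH] j le_n; have [le_nj|lt_jn] := leqP n j.
- exact: (all_core 1%N).
- apply: spanned_values_step => //; apply: (all_core 0%N).
  by rewrite -addn1.
- exact: (all_core k.+2).
apply: spanned_values_step => //; apply: spannedS (IH j.+1 _); last by rewrite addSnnS.
by apply: valuesS => i; case: ifP => _ x //; exact: orbit_sum_core_sub.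
Qed.

Lemma spanned_values_orbit_sum k : multilinear w -> (n <= k.+1)%N ->
  spanned (wvalues w (orbit_sum (core N k))).
Proof. by move=> mw le_n; apply: (@spanned_values_mixed k 0%N). Qed.

End MultilinearValues.

(** * Generalised codimensions *)

Section GeneralisedCodimension.
Variables (R : realType) (F : fieldType) (G : nalgebra F).
Variables (L : set (subspace G)) (codim : subspace G -> R).
Hypotheses (stL : stable_class L) (gcL : gen_codim L codim).
Implicit Types (K N A B : subspace G) (phi : aut G).

(** A lower bound of the pair [K], [K] gives codim K <= codim K + codim K. *)
Lemma codim_ge0 K : L K -> 0 <= codim K.
Proof.
move=> LK; have [A [LA AK _ cA]] := gc_meet gcL LK LK.
have := le_trans (gc_mono gcL LK LA AK) cA.
by rewrite lerDl.
Qed.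

Lemma codim_cap A B : L A -> L B -> codim (capsub A B) <= codim A + codim B.
Proof.
move=> LA LB; have [D [LD DA DB]] := gc_meet gcL LA LB.
apply: le_trans; apply: (gc_mono gcL) => //; first exact: stable_cap.
by move=> x xD; rewrite capsubE DA ?DB.
Qed.

Lemma codim_cap_images K s : L K ->
  codim (cap_images K s) <= codim K * ((size s)%:R + 1).
Proof.
move=> LK; elim: s => [|phi s IH] /=; first by rewrite add0r mulr1.
apply: le_trans (codim_cap _ _) _; first exact: stable_im.
  exact: stable_cap_images.
rewrite -natr1 -addrA mulrDr.
rewrite [X in _ <= X]addrC mulrDr mulr1.
rewrite -addrA; apply: lerD; first exact: gc_aut gcL _ _ (aut_mapP phi) LK.
by rewrite mulrDr mulr1 addrC in IH.
Qed.

(* The family in [gc_sup] need not contain [K] itself; applying the inverse of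
   one of the automorphisms makes it do so. *)
Lemma codim_covers K : L K ->
  exists2 s, covers K s & (size s)%:R <= codim K.
Proof.
move=> LK; pose P : set (subspace G) := [set J | exists phi, J = imsub phi K :> subspace G].
have PL : P `<=` L by move=> _ [phi ->]; apply: stable_im.
have P1 : P (imsub (aut1 G) K) by exists (aut1 G).
have c1 : codim (imsub (aut1 G) K) <= codim K.
  exact: gc_aut gcL _ _ (aut_mapP _) LK.
(* Invariance and monotonicity show that no image exceeds the image under the identity, which has
   the same elements as [K]. *)
have Pmax J : P J -> codim J <= codim (imsub (aut1 G) K).
  case=> phi ->; apply: (le_trans (gc_aut gcL (aut_mapP phi) LK)).
  apply: (gc_mono gcL) => //; first exact: PL.
  by move=> x; rewrite imsub_aut1.
have [r [J [le_r PJ supJ]]] := gc_sup gcL PL P1 Pmax.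
have {le_r} : r%:R <= codim K + 1 by apply: le_trans le_r _; rewrite lerD2r.
have /choice[phi hphi] i : exists phi, J i = imsub phi K :> subspace G := PJ i.
(* If no member is selected, the sum of all images lies in every subspace, and the empty list
   covers. *)
case: r J PJ supJ phi hphi => [|r] J PJ supJ phi hphi le_r.
  exists [::]; last exact: codim_ge0.
  move=> psi x xK; have : x \in lhull (\bigcup_(J in P) [set` J]).
    by apply: sub_lhull; exists (imsub psi K : subspace G) => //; exists psi.
  by rewrite supJ; apply: lhull_min => y [[]].
have [psi [phiK psiK]] := autV (phi ord0).
(* After [psi], the first selected image becomes [K], which need not be listed. The r others remain,
   and r + 1 <= codim K + 1 yields the bound. *)
exists [seq autM psi (phi (lift ord0 i)) | i <- enum 'I_r]; last first.
  by rewrite size_map size_enum_ord -(lerD2r 1) natr1.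
set s := map _ _ => chi x xK.
have : phi ord0 x \in lhull (\bigcup_(J in P) [set` J]).
  apply: sub_lhull; exists (imsub (autM (phi ord0) chi) K : subspace G).
    by exists (autM (phi ord0) chi).
  have /imsubP[y yK <-] := xK.
  exact: (mem_imsub (autM (phi ord0) chi) yK).
rewrite supJ => xJ.
have : phi ord0 x \in imsub (phi ord0) (sum_images K s).
  apply: lhull_min xJ => y [i _ /=]; rewrite hphi => /imsubP[z zK <-].
  case: (unliftP ord0 i) => [j|] ->; last by apply/mem_imsub/sum_images_base.
  rewrite -(psiK (phi (lift ord0 j) z)); apply: mem_imsub.
  apply: (@sum_images_mem _ _ _ _ (autM psi (phi (lift ord0 j)))).
    by apply: map_f; rewrite mem_enum.
  exact: (mem_imsub (autM psi (phi (lift ord0 j)))).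
by case/imsubP=> y yS /(can_inj phiK) <-.
Qed.

Lemma codim_core N k : L N ->
  codim (core N k) <= iter k (fun x => x * (x + 1)) (codim N).
Proof.
move=> LN; elim: k => //= k; set K := core N k; set d := iter _ _ _ => IH.
have LK : L K by apply: stable_core.
have [s cs sK] := codim_covers LK.
apply: le_trans (codim_cap_images _ LK) _.
have sd : (size (mincover K))%:R <= d.
  by apply: le_trans (le_trans sK IH); rewrite ler_nat size_mincover.
by rewrite ler_pM ?lerD2r ?codim_ge0 // addr_ge0.
Qed.

Lemma codim_orbit_sum_core N k : L N ->
  codim (orbit_sum (core N k)) <= iter k (fun x => x * (x + 1)) (codim N).
Proof.
move=> LN; apply: le_trans (codim_core k LN); apply: (gc_mono gcL).
- by apply: stable_orbit_sum => //; apply: stable_core.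
- exact: stable_core.
- exact: sum_images_base.
Qed.

End GeneralisedCodimension.

(** * Finite covers from the three hypotheses, and the conclusions *)

Lemma covers_core (F : fieldType) (G : nalgebra F) (N : subspace G) :
  [\/ exists d, has_codim N d,
      exists hN : left_ideal N, noetherian_module (quot_mod hN)
    | exists hN : ideal N, max_condition_ideals (quot_alg hN)] ->
  forall k, exists s, covers (core N k) s.
Proof.
(* Hypotheses (b) and (c) act through chain conditions in the classes of left ideals and of ideals;
   finite codimension gives covers directly. *)
have acc_cov C : stable_class C -> C N -> acc C N ->
    forall k, exists s, covers (core N k) s.
  move=> stC CN accN k; apply: (acc_covers stC); first exact: stable_core.
  exact: acc_core.
case=> [[d /has_codim_codim_le/codim_le_core cN] k|[hN]|[hN]].
- by have [s cs _] := codim_le_covers (cN k); exists s.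
- by move/noetherian_acc; apply: acc_cov => //; exact: stable_left_ideal.
- by move/max_condition_acc; apply: acc_cov => //; exact: stable_ideal.
Qed.

Theorem mainTheorem7 (R : realType) (F : fieldType) (G : nalgebra F)
    (N : subspace G) :
  [\/ exists d, has_codim N d,
      exists hN : left_ideal N, noetherian_module (quot_mod hN)
    | exists hN : ideal N, max_condition_ideals (quot_alg hN)] ->
  exists H : nat -> subspace G, forall t : nat, (0 < t)%N ->
    [/\ characteristic (H t),
        [/\ lattice_gen (aut_images N) [set` H t],
            right_ideal N -> right_ideal (H t),
            forall hN : left_ideal N,
              exists hH : left_ideal (H t),
                mod_formation_gen (quot_mod hN) (quot_mod hH)
          & forall hN : ideal N,
              exists hH : ideal (H t),
                alg_formation_gen (quot_alg hN) (quot_alg hH)],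
        forall (n : nat) (w : free_nalg F n), (n <= t)%N -> multilinear w ->
          exists (r : nat) (phi : 'I_r -> {linear G -> G}),
            (forall i, automorphism (phi i)) /\
            (forall v, wvalues w (H t) v ->
               v \in lhull (\bigcup_i (phi i @` wvalues w N)))
      & [/\ forall d, has_codim N d ->
              exists2 e, has_codim (H t) e &
                (e <= iter t.-1 (fun x => x * (x + 1)) d)%N,
            forall (hN : ideal N) (codim : subspace G -> R),
              gen_codim (alg_lattice hN) codim ->
              codim (H t) <= iter t.-1 (fun x => x * (x + 1)) (codim N)
          & forall (hN : left_ideal N) (codim : subspace G -> R),
              gen_codim (mod_lattice hN) codim ->
              codim (H t) <= iter t.-1 (fun x => x * (x + 1)) (codim N)]].
Proof.
(* Cores are numbered from 0, so N_t is [core N t.-1]. *)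
move/covers_core => cov; exists (fun t => orbit_sum (core N t.-1)) => t t_gt0.
have stable C : stable_class C -> C N -> C (orbit_sum (core N t.-1)).
  by move=> stC CN; apply: stable_orbit_sum => //; apply: stable_core.
split.
- exact: characteristic_orbit_sum.
- split.
  + exact: stable (stable_lattice_gen N) (lattice_gen_self N).
  + exact: stable stable_right_ideal.
  + by move=> hN; apply: (stable _ (stable_mod_lattice hN)); exists hN.
  + by move=> hN; apply: (stable _ (stable_alg_lattice hN)); exists hN.
- move=> n w le_nt mw.
  have [|L hL] := @spanned_values_orbit_sum _ _ _ _ _ (fun k => mincoverP (cov k)) t.-1 mw.
    by rewrite prednK.
  exists (size L), (fun i => tnth (in_tuple L) i); split.
    by move=> i; apply: aut_mapP.
  move=> v /hL; apply: lhullS => u [phi /= phiL phiu].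
  have /tnthP[i def_phi] : phi \in in_tuple L by [].
  by exists i => //; rewrite -def_phi.
split=> [d /has_codim_codim_le cN|hN codim gc|hN codim gc].
(* The orbit sum contains the core, so it inherits the bound for the core. *)
- have cH : codim_le (orbit_sum (core N t.-1)) (iter t.-1 (fun x => x * (x + 1))%N d).
    exact: codim_le_sub (@sum_images_base _ _ _ _) (codim_le_core _ cN).
  by have [e ? ?] := codim_le_has_codim cH; exists e.
- by apply: (codim_orbit_sum_core (stable_alg_lattice hN)) => //; exists hN.
- by apply: (codim_orbit_sum_core (stable_mod_lattice hN)) => //; exists hN.
Qed.
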